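(* Let $p\geq 5$ be a prime. Then the minimum nonzero Hamming weight of $C_p^\perp$ is $2p$, and the second smallest nonzero Hamming weight of $C_p^\perp$ is $3p-3$.
   Context: Let $p$ be a prime, $\mathbb{F}_p=\mathbb{Z}/p\mathbb{Z}$, and $\pi_p$ the projective plane over $\mathbb{F}_p$ with point set $P$. Let $V_p=\mathbb{F}_p^P$, with the bilinear form $\langle w,w'\rangle=\sum_{x\in P}w(x)w'(x)$. Each line of $\pi_p$ is identified with its indicator function in $V_p$. $C_p$ is the subspace of $V_p$ spanned by all lines, and $C_p^\perp=\{w\in V_p:\langle w,c\rangle=0 \text{ for all } c\in C_p\}$. The Hamming weight of $w$ is the number of points $x$ with $w(x)\neq 0$. *)

(* Defs.v *)
From HB Require Import structures.
From mathcomp Require Import all_boot all_order all_algebra all_field.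

Set Implicit Arguments.
Unset Strict Implicit.
Unset Printing Implicit Defensive.

Import GRing.Theory.
Local Open Scope ring_scope.

(* Finiteness is needed in order to index functions and sums by the points
   and lines of the plane. *)
HB.instance Definition _ (F : finFieldType) (vT : vectType F) :
    isCountable {vspace vT} :=
  CanIsCountable (@VectorInternalTheory.vs2mxK F vT).
HB.instance Definition _ (F : finFieldType) (vT : vectType F) :
    isFinite {vspace vT} :=
  CanIsFinite (@VectorInternalTheory.vs2mxK F vT).

Section ProjectivePlaneCode.

Variable p : nat.

Definition point : predArgType := {x : {vspace 'rV['F_p]_3} | \dim x == 1%N}.
Definition line : predArgType := {l : {vspace 'rV['F_p]_3} | \dim l == 2%N}.

HB.instance Definition _ := Finite.on point.
HB.instance Definition _ := Finite.on line.

Definition incident (x : point) (l : line) : bool := (val x <= val l)%VS.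

(* The regular module structure [^o] on 'F_p makes this type a vectType. *)
Definition Vp := {ffun point -> ('F_p)^o}.

HB.instance Definition _ := Vector.on Vp.

Definition dotp (w w' : Vp) : 'F_p := \sum_(x : point) w x * w' x.

Definition line_vec (l : line) : Vp := [ffun x => (incident x l)%:R].

Definition Cp : {vspace Vp} := <<[seq line_vec l | l : line]>>%VS.

Definition in_Cp_dual (w : Vp) : Prop := forall c : Vp, c \in Cp -> dotp w c = 0.

Definition hweight (w : Vp) : nat := #|[pred x : point | w x != 0]|.

Definition dual_weight (d : nat) : Prop :=
  d <> 0%N /\ exists w : Vp, in_Cp_dual w /\ hweight w = d.

End ProjectivePlaneCode.

Definition is_smallest (S : nat -> Prop) (m : nat) : Prop :=
  S m /\ forall n : nat, S n -> (m <= n)%N.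

Definition is_second_smallest (S : nat -> Prop) (m : nat) : Prop :=
  exists m0 : nat,
    is_smallest S m0 /\ is_smallest (fun n : nat => S n /\ n <> m0) m.

(* Main.v *)
Require Import Defs.
From mathcomp Require Import all_boot all_algebra all_field zify ring.

(** A codeword of the dual is a function [W] on the nonzero vectors of [F_p^3]
that is constant on lines through the origin and sums to zero over every plane.
Since [L^(p-1)] is the indicator of the complement of the plane [L = 0],
polarization (legitimate as [(p-1)!] is invertible) gives
[sum_v W v * L_1 v * ... * L_(p-1) v = 0] for all linear forms [L_i]; that is,
[W] behaves like a plane curve of degree [p - 1], and choosing the [L_i] to
vanish on most of the support yields lower bounds for it.

Call a line missing if it does not meet the support [S].  If two distinct lines
are missing, let [r] be the number of lines through their intersection that meet
[S]; each of these contains at least [p + 2 - r] points of [S], so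
[|S| >= r (p + 2 - r)], which leaves [|S| = 2p] (for [r = 2]) or [|S| >= 3p - 3].

Otherwise at most one line is missing.  Every zero of [W] has a tangent line, and
a non-missing line that is tangent at [t] zeros contains at least [t + 2] points
of [S], as a polynomial of degree [p - 1] has few roots counted with multiplicity.
Summing over the lines (the Homma-Kim count for plane curves without linear
components) gives [|S| (p + 2) >= 3 p^2 + 2 p], hence [|S| >= 3p - 3]. *)

Set Implicit Arguments.
Unset Strict Implicit.
Unset Printing Implicit Defensive.

Import GRing.Theory.
Local Open Scope ring_scope.

(** * Vectors and linear forms in three variables *)

Section Coordinates.
Variable F : finFieldType.
Implicit Types (v : 'rV[F]_3) (l : 'cV[F]_3) (x y z : F).

Definition ev v l : F := (v *m l) 0 0.

Lemma evDl v v' l : ev (v + v') l = ev v l + ev v' l.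
Proof. by rewrite /ev mulmxDl mxE. Qed.

Lemma evZl c v l : ev (c *: v) l = c * ev v l.
Proof. by rewrite /ev -scalemxAl mxE. Qed.

Lemma evDr v l l' : ev v (l + l') = ev v l + ev v l'.
Proof. by rewrite /ev mulmxDr mxE. Qed.

Lemma evZr c v l : ev v (c *: l) = c * ev v l.
Proof. by rewrite /ev -scalemxAr mxE. Qed.

Lemma ev0r v : ev v 0 = 0.
Proof. by rewrite /ev mulmx0 mxE. Qed.

Lemma ev_mulmx v (g : 'M_3) l : ev (v *m g) l = ev v (g *m l).
Proof. by rewrite /ev mulmxA. Qed.

Definition vec3 x y z : 'rV[F]_3 := \row_j [:: x; y; z]`_j.
Definition form3 x y z : 'cV[F]_3 := \col_j [:: x; y; z]`_j.

Lemma ev_vec3 x y z a b c : ev (vec3 x y z) (form3 a b c) = x * a + y * b + z * c.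
Proof. by rewrite /ev mxE !big_ord_recl big_ord0 !mxE /= addr0 addrA. Qed.

Lemma vec3E v : v = vec3 (v 0 0) (v 0 1) (v 0 2).
Proof.
apply/rowP=> j; rewrite mxE; case: j => -[|[|[|//]]] lj /=;
  by congr (v _ _); apply: val_inj.
Qed.

Lemma vec3K x y z :
  [/\ vec3 x y z 0 0 = x, vec3 x y z 0 1 = y & vec3 x y z 0 2 = z].
Proof. by rewrite !mxE. Qed.

Lemma vec3D x y z x' y' z' :
  vec3 x y z + vec3 x' y' z' = vec3 (x + x') (y + y') (z + z').
Proof. by apply/rowP=> j; rewrite !mxE; case: j => -[|[|[|//]]]. Qed.

Lemma vec3Z c x y z : c *: vec3 x y z = vec3 (c * x) (c * y) (c * z).
Proof. by apply/rowP=> j; rewrite !mxE; case: j => -[|[|[|//]]]. Qed.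

Lemma vec3_eq0 x y z : (vec3 x y z == 0) = [&& x == 0, y == 0 & z == 0].
Proof.
apply/eqP/and3P=> [e|[/eqP-> /eqP-> /eqP->]].
  by have := vec3K x y z; rewrite e !mxE => -[<- <- <-]; rewrite eqxx.
by apply/rowP=> j; rewrite !mxE; case: j => -[|[|[|//]]].
Qed.

Lemma form3_eq0 x y z : (form3 x y z == 0) = [&& x == 0, y == 0 & z == 0].
Proof.
rewrite -vec3_eq0 -(inj_eq trmx_inj) trmx0; congr (_ == 0).
by apply/rowP=> j; rewrite !mxE.
Qed.

Lemma big_vec3 (R : Type) (idx : R) (op : Monoid.com_law idx) (f : 'rV[F]_3 -> R) :
  \big[op/idx]_v f v =
  \big[op/idx]_x \big[op/idx]_y \big[op/idx]_z f (vec3 x y z).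
Proof.
rewrite (reindex (fun t : F * F * F => vec3 t.1.1 t.1.2 t.2)) /=.
  by rewrite pair_big pair_big.
exists (fun v => (v 0 0, v 0 1, v 0 2)) => [[[x y] z] _|v _] /=.
  by have [-> -> ->] := vec3K x y z.
by rewrite -vec3E.
Qed.

Lemma big_mulmx (R : Type) (idx : R) (op : Monoid.com_law idx) (g : 'M[F]_3) (f : 'rV[F]_3 -> R)
    (P : pred 'rV[F]_3) :
  g \in unitmx ->
  \big[op/idx]_(v | P v) f v = \big[op/idx]_(v | P (v *m g)) f (v *m g).
Proof.
move=> gU; rewrite (reindex (fun v => v *m g)) //=.
by exists (fun v => v *m invmx g) => v _; rewrite ?mulmxK ?mulmxKV.
Qed.

Lemma row_free_transitive k (A B : 'M[F]_(k, 3)) :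
  row_free A -> row_free B -> exists2 g, g \in unitmx & A *m g = B.
Proof.
move=> fA fB.
have e : A *m (pinvmx A *m B) = B by rewrite mulmxA mulmxVp // mul1mx.
have [|g gU eg] := @complete_unitmx _ _ _ A (pinvmx A *m B).
  by rewrite e (eqP fA) (eqP fB).
by exists g; rewrite // -eg.
Qed.

Lemma row_free_rV v : v != 0 -> row_free v.
Proof. by move=> v0; rewrite /row_free rank_rV v0. Qed.

Lemma vec_transitive v v' : v != 0 -> v' != 0 -> exists2 g, g \in unitmx & v *m g = v'.
Proof. by move=> v0 v'0; apply: row_free_transitive; apply: row_free_rV. Qed.

Lemma form_transitive l l' : l != 0 -> l' != 0 -> exists2 g, g \in unitmx & g *m l = l'.
Proof.
move=> l0 l'0.
have trN0 (m : 'cV[F]_3) : m != 0 -> m^T != 0.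
  by rewrite -(inj_eq (@trmx_inj _ 3 1)) trmx0.
have [g gU eg] := vec_transitive (trN0 _ l0) (trN0 _ l'0).
by exists g^T; rewrite ?unitmx_tr // -[RHS]trmxK -eg trmx_mul trmxK.
Qed.

(** Lets two distinct missing lines be taken as [x = 0] and [y = 0]. Transposed and stacked, two
    independent forms make a row-free matrix, and invertible matrices act transitively on those. *)
Lemma form2_transitive l1 l2 : l2 != 0 -> (forall c, l1 != c *: l2) ->
  exists g, [/\ g \in unitmx, g *m l1 = form3 1 0 0 & g *m l2 = form3 0 1 0].
Proof.
move=> l20 nl12.
pose U m1 m2 : 'M[F]_(1 + 1, 3) := col_mx (m1 : 'cV[F]_3)^T (m2 : 'cV[F]_3)^T.
have free m1 m2 : m2 != 0 -> (forall c, m1 != c *: m2) -> row_free (U m1 m2).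
  move=> m20 nm; apply: inj_row_free => w.
  rewrite -[w]hsubmxK mul_row_col [lsubmx w]mx11_scalar [rsubmx w]mx11_scalar.
  set a := lsubmx w 0 0; set b := rsubmx w 0 0.
  rewrite !mul_scalar_mx -!linearZ -linearD /= => /(canRL trmxK); rewrite trmx0 => e.
  have a0 : a = 0.
    apply/eqP/negP=> /negP a0; case/negP: (nm (- (b / a))).
    move: e => /eqP; rewrite addr_eq0 => /eqP e.
    by rewrite -[m1](scalerK a0) e scalerN scalerA scaleNr mulrC.
  move: e; rewrite a0 scale0r add0r => /eqP; rewrite scaler_eq0 (negPf m20) orbF.
  move/eqP->.
  by rewrite -[RHS]hsubmxK !linear0; congr row_mx; rewrite -scalemx1 scale0r.
have fe : row_free (U (form3 1 0 0) (form3 0 1 0)).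
  apply: free => [|c]; first by rewrite form3_eq0 oner_eq0 andbF.
  apply/eqP=> /(congr1 (ev (vec3 1 0 0))); rewrite evZr !ev_vec3 !(mul0r, mulr0, mul1r, addr0).
  by move/eqP; rewrite oner_eq0.
have [g gU eg] := row_free_transitive (free _ _ l20 nl12) fe.
move: eg; rewrite /U mul_col_mx => /eq_col_mx [e1 e2].
by exists g^T; rewrite unitmx_tr; split; rewrite // -[RHS]trmxK -?e1 -?e2 trmx_mul trmxK.
Qed.

Lemma card_ker_form l : l != 0 -> #|[set v | ev v l == 0]| = (#|F| ^ 2)%N.
Proof.
move=> l0.
have [|g gU eg] := form_transitive l0 (l' := form3 1 0 0).
  by rewrite form3_eq0 oner_eq0.
rewrite -sum1_card; under eq_bigl => v do rewrite inE.
rewrite (big_mulmx _ _ _ gU).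
under eq_bigl => v do rewrite ev_mulmx eg.
rewrite big_mkcond big_vec3 (bigD1 0) //= [X in (_ + X)%N]big1 => [|x x0]; last first.
  by apply: big1 => y _; apply: big1 => z _; rewrite ev_vec3 !mulr0 !addr0 mulr1 (negPf x0).
rewrite addn0 (eq_bigr (fun=> #|F|)) => [|y _]; last first.
  rewrite -sum1_card; apply: eq_bigr => z _.
  by rewrite ev_vec3 !mulr0 mul0r !addr0 eqxx.
by rewrite sum_nat_const cardT -cardE mulnn.
Qed.

Lemma card_ann_vec v : v != 0 -> #|[set l | ev v l == 0]| = (#|F| ^ 2)%N.
Proof.
move=> v0; rewrite -(@card_ker_form v^T); last by rewrite -(inj_eq trmx_inj) trmxK trmx0.
rewrite -(card_imset _ (@trmx_inj _ 3 1)); congr #|pred_of_set _|.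
have evT (l : 'cV[F]_3) : ev l^T v^T = ev v l by rewrite /ev -trmx_mul mxE.
apply/setP=> u; rewrite inE; apply/imsetP/idP => [[l]|e].
  by rewrite inE => e ->; rewrite evT.
by exists u^T; rewrite ?trmxK // inE -evT trmxK.
Qed.

(** An injective map from pairs of scalars into a kernel with equally many elements is a bijection.
    The monoid is arbitrary because the formula serves both sums in [F] and cardinalities. *)
Lemma ker_form_basis l v : l != 0 -> v != 0 -> ev v l = 0 ->
  exists v' : 'rV[F]_3,
    (forall s t, ev (s *: v + t *: v') l = 0) /\
    (forall (R : Type) (idx : R) (op : Monoid.com_law idx) (f : 'rV[F]_3 -> R),
      \big[op/idx]_(u | ev u l == 0) f u =
      \big[op/idx]_s \big[op/idx]_t f (s *: v + t *: v')).
Proof.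
move=> l0 v0 vl.
have q1 : (1 < #|F|)%N by exact: finNzRing_gt1.
have: ~~ ([set u | ev u l == 0] \subset [set s *: v | s : F]).
  apply: contraL (leq_imset_card (fun s => s *: v) (mem F)) => /subset_leq_card.
  by rewrite card_ker_form // -ltnNge => /(leq_trans _)-> //; rewrite -{1}[#|F|]expn1 ltn_exp2l.
case/subsetPn=> v'; rewrite inE => /eqP v'l nv'.
have ev0 s t : ev (s *: v + t *: v') l = 0 by rewrite evDl !evZl vl v'l !mulr0 addr0.
exists v'; split=> // R idx op f.
pose h (st : F * F) : 'rV[F]_3 := st.1 *: v + st.2 *: v'.
have h_inj : injective h.
  move=> [s t] [s' t']; rewrite /h /= => /eqP.
  rewrite -subr_eq0 opprD addrACA -!scalerBl => e.
  have et : t - t' = 0.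
    apply/eqP/negP=> /negP t0; case/negP: nv'; apply/imsetP.
    exists (- ((s - s') / (t - t'))) => //.
    rewrite addrC addr_eq0 in e; apply: (can_inj (scalerK t0)).
    by rewrite (eqP e) scalerA mulrN mulrC divfK // scaleNr.
  move: e; rewrite et scale0r addr0 scaler_eq0 (negPf v0) orbF subr_eq0 => /eqP->.
  by move/subr0_eq: et => ->.
have imh : [set h x | x in [set: F * F]] = [set u | ev u l == 0].
  apply/eqP; rewrite eqEcard; apply/andP; split.
    by apply/subsetP=> _ /imsetP[st _ ->]; rewrite inE ev0.
  by rewrite card_imset // card_ker_form // cardsT card_prod mulnn.
rewrite -(eq_bigl _ _ (in_set (fun u => ev u l == 0))) -imh.
by rewrite big_imset ?pair_big //=; [apply: eq_big => // x; rewrite inE | move=> ? ? _ _ /h_inj].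
Qed.

(** Apart from the origin, each pair is a unique nonzero multiple of [(1, 0)] or of some
    [(m, 1)]. *)
Lemma sum_homogeneous (A : nmodType) (G : F -> F -> A) :
    (forall c s t, c != 0 -> G (c * s) (c * t) = G s t) ->
  \sum_s \sum_t G s t = G 0 0 + (G 1 0 + \sum_m G m 1) *+ #|F|.-1.
Proof.
move=> hG; rewrite exchange_big (bigD1 0) //= (bigD1 0) //= -addrA; congr (_ + _).
rewrite mulrnDl; congr (_ + _).
  rewrite (eq_bigr (fun=> G 1 0)) => [|s s0]; last first.
    by rewrite -[in RHS](hG s) // mulr1 mulr0.
  by rewrite sumr_const; congr (_ *+ _); rewrite -(cardC1 (0 : F)); apply: eq_card.
rewrite (eq_bigr (fun=> \sum_m G m 1)) => [|t t0]; last first.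
  rewrite (reindex (fun m => t * m)) /=.
    by apply: eq_bigr => m _; rewrite -{2}[t]mulr1 hG.
  by exists (fun m => t^-1 * m) => m _; rewrite mulrA ?mulVf ?divff ?mul1r.
by rewrite sumr_const; congr (_ *+ _); rewrite -(cardC1 (0 : F)); apply: eq_card.
Qed.

End Coordinates.

Lemma sum_homogeneous_nat (F : finFieldType) (G : F -> F -> nat) :
    (forall c s t, c != 0 -> G (c * s) (c * t) = G s t) ->
  (\sum_s \sum_t G s t = G 0%R 0%R + (G 1%R 0%R + \sum_m G m 1%R) * #|F|.-1)%N.
Proof.
move=> hG; rewrite (sum_homogeneous (A := nat) hG); congr (_ + _)%N.
by elim: _.-1 => [|n IHn]; rewrite ?muln0 // mulrS mulnS IHn.
Qed.

Lemma sum_scalar_multiples (F : finFieldType) (A : zmodType) (G : F -> A) :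
  G 0 = 0 -> (forall c, c != 0 -> G c = G 1) -> \sum_c G c = G 1 *+ #|F|.-1.
Proof.
move=> G0 G1; rewrite (bigD1 0) //= G0 add0r (eq_bigr (fun=> G 1)) => [|c]; last exact: G1.
by rewrite sumr_const; congr (_ *+ _); rewrite -(cardC1 (0 : F)); apply: eq_card.
Qed.

(** * Polarization *)

Section Polarization.
Variable p : nat.
Hypothesis p_prime : prime p.
Local Notation F := 'F_p.
Implicit Types (v : 'rV[F]_3) (l : 'cV[F]_3).

Lemma natr_pred_Fp : p.-1%:R = -1 :> F.
Proof.
apply/eqP; rewrite -subr_eq0 opprK natr1 prednK ?prime_gt0 //.
by rewrite -(dvdn_pcharf (pchar_Fp p_prime)).
Qed.

Lemma expf_pred_Fp (x : F) : x ^+ p.-1 = (x != 0)%:R.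
Proof.
have [->|x0] := eqVneq x 0.
  by rewrite expr0n -subn1 subn_eq0 leqNgt prime_gt1.
apply: (mulfI x0); rewrite -exprS prednK ?prime_gt0 // mulr1.
by rewrite -{2}[x]expf_card card_Fp.
Qed.

(** Induction on [n]: the hypothesis for [l + t *: m] is a polynomial identity in [t] of degree at
    most [n + 1 < p], valid for all [p] scalars, so every coefficient vanishes. That of [t] is the
    invertible [n + 1] times the [n]-th moment of [f] weighted by [m]. *)
Lemma polarization n (f : 'rV[F]_3 -> F) : (n < p)%N ->
    (forall l, \sum_v f v * ev v l ^+ n = 0) ->
  forall ls, size ls = n -> \sum_v f v * \prod_(l <- ls) ev v l = 0.
Proof.
elim: n f => [|n IHn] f lt_np f0 [|m ls] //= sz.
  by rewrite -[RHS](f0 0); apply: eq_bigr => v _; rewrite big_nil.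
under eq_bigr => v _ do rewrite big_cons mulrA.
apply: IHn; [exact: ltnW | | by case: sz] => l.
pose mom j := \sum_v f v * ev v l ^+ (n.+1 - j) * ev v m ^+ j.
pose q := \poly_(j < n.+2) (mom j *+ 'C(n.+1, j)).
have q0 : q = 0.
  apply/eqP; apply: contraLR lt_np => q0; rewrite -leqNgt.
  suff /(max_poly_roots q0) /(_ (enum_uniq F)) : all (root q) (enum F).
    by rewrite -cardE card_Fp // => /leq_trans /(_ (size_poly _ _)).
  apply/allP=> t _; rewrite /root /q horner_poly -[X in _ == X](f0 (l + t *: m)).
  apply/eqP; under [RHS]eq_bigr => v _ do rewrite evDr evZr exprDn mulr_sumr.
  rewrite [RHS]exchange_big; apply: eq_bigr => j _ /=.
  rewrite /mom mulrnAl mulr_suml -sumrMnl; apply: eq_bigr => v _.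
  by rewrite exprMn mulrnAr; congr (_ *+ _); ring.
have := coef_poly n.+2 (fun j => mom j *+ 'C(n.+1, j)) 1; rewrite -/q q0 coef0 /= bin1.
rewrite -mulr_natl => /esym/eqP; rewrite mulf_eq0 -(dvdn_pcharf (pchar_Fp p_prime)).
rewrite gtnNdvd //= /mom subSS subn0 => /eqP {2}<-; apply: eq_bigr => v _.
by rewrite expr1 mulrAC.
Qed.

(* The case [l = 0] of the last condition says that all the values sum to [0]. *)
Definition cone_codeword (W : 'rV[F]_3 -> F) : Prop :=
  [/\ W 0 = 0, forall c v, c != 0 -> W (c *: v) = W v
    & forall l, \sum_(v | ev v l == 0) W v = 0].

Lemma cone_codeword_mulmx W g :
  g \in unitmx -> cone_codeword W -> cone_codeword (fun v => W (v *m g)).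
Proof.
move=> gU [W0 WZ Wl]; split=> [|c v c0|l]; rewrite ?mul0mx -?scalemxAl ?WZ //.
rewrite -[RHS](Wl (invmx g *m l)) [RHS](big_mulmx _ _ _ gU); apply: eq_bigl => v.
by rewrite ev_mulmx mulKVmx.
Qed.

Lemma cone_codeword_forms W ls : cone_codeword W -> size ls = p.-1 ->
  \sum_v W v * \prod_(l <- ls) ev v l = 0.
Proof.
move=> [_ _ Wl]; apply: polarization => [|l]; first by rewrite prednK ?prime_gt0.
have sumW : \sum_v W v = 0.
  by rewrite -[RHS](Wl 0); apply: eq_bigl => v; rewrite ev0r eqxx.
transitivity (\sum_v W v - \sum_(v | ev v l == 0) W v); last by rewrite Wl sumW subrr.
rewrite [X in _ - X]big_mkcond -sumrB; apply: eq_bigr => v _; rewrite expf_pred_Fp //.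
by case: eqP; rewrite /= ?mulr0 ?mulr1 ?subrr ?subr0.
Qed.

End Polarization.

(** * Tangent lines *)

Section Tangents.
Variable p : nat.
Hypotheses (p_prime : prime p) (p_gt2 : (2 < p)%N).
Local Notation F := 'F_p.
Implicit Types (W : 'rV[F]_3 -> F) (v : 'rV[F]_3) (l : 'cV[F]_3).

(** The sum over the plane spanned by [(x, y, 0)] and [(0, 0, 1)] is the sum of [H (c * x) (c * y)]
    over [c]. The [p - 1] nonzero [c] contribute [H x y] each, and [c = 0] nothing, since [W]
    vanishes on the multiples of [(0, 0, 1)]. *)
Lemma cone_line_sum_vec3 W x y : cone_codeword W -> W (vec3 0 0 1) = 0 ->
  \sum_z W (vec3 x y z) = 0.
Proof.
move=> [W0 WZ Wl] W001; pose H x y := \sum_z W (vec3 x y z).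
have HZ c a b : c != 0 -> H (c * a) (c * b) = H a b.
  move=> c0; rewrite /H (reindex (fun z => c * z)) /=.
    by apply: eq_bigr => z _; rewrite -vec3Z WZ.
  by exists (fun z => c^-1 * z) => z _; rewrite mulrA ?mulVf ?divff ?mul1r.
have H0 : H 0 0 = 0.
  apply: big1 => z _; have [->|z0] := eqVneq z 0.
    by rewrite -[RHS]W0; congr W; apply/eqP; rewrite vec3_eq0 eqxx.
  by rewrite -[RHS]W001 -[RHS](WZ z) // vec3Z !mulr0 mulr1.
have Hc a b : \sum_c H (c * a) (c * b) = 0 -> H a b = 0.
  rewrite sum_scalar_multiples ?mul0r // => [|c c0]; last by rewrite HZ // !mul1r.
  rewrite card_Fp // -mulr_natr natr_pred_Fp // mulrN mulr1 !mul1r => /eqP.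
  by rewrite oppr_eq0 => /eqP.
have [x0|x0] := eqVneq x 0.
  have H1 : H 0 1 = 0.
    apply: Hc; rewrite -[RHS](Wl (form3 1 0 0)) [RHS]big_mkcond [RHS]big_vec3 [RHS](bigD1 0) //=.
    rewrite [X in _ = _ + X]big1 => [|a a0]; last first.
      by apply: big1 => b _; apply: big1 => c _; rewrite ev_vec3 !mulr0 !addr0 mulr1 (negPf a0).
    rewrite addr0; apply: eq_bigr => b _; apply: eq_bigr => c _.
    by rewrite ev_vec3 !mulr0 !mulr1 !addr0 eqxx.
  have [->|y0] := eqVneq y 0; first by rewrite x0; apply: H0.
  by rewrite x0 -[RHS]H1 -[RHS](HZ y) // mulr0 mulr1.
apply: (Hc x y); rewrite -[RHS](Wl (form3 y (- x) 0)) [RHS]big_mkcond [RHS]big_vec3.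
rewrite (reindex (fun a => x^-1 * a)) /=; last first.
  by exists (fun z => x * z) => z _; rewrite mulrA ?mulVf ?divff ?mul1r.
apply: eq_bigr => a _; rewrite [RHS](bigD1 (x^-1 * a * y)) //=.
rewrite [X in _ = _ + X]big1 => [|b ba]; last first.
  apply: big1 => c _; rewrite ev_vec3 mulr0 addr0; case: eqP => // e; case/eqP: ba.
  apply: (mulfI x0); rewrite !mulrA divff // mul1r mulrC; apply/eqP.
  by rewrite -subr_eq0 -[X in _ == X]oppr0 -e; apply/eqP; ring.
have exy : a * y + x^-1 * a * y * - x = 0 by field.
rewrite addr0 [in LHS](_ : x^-1 * a * x = a); last by field.
by apply: eq_bigr => c _; rewrite ev_vec3 mulr0 addr0 exy eqxx.
Qed.

(** [E x y] behaves like a linear form in [x] and [y]: up to sign, the coefficient of [z^(p-2)] in a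
    polynomial of degree [p - 1]. The identity [lin] expresses this, and a linear form in two
    variables has a nontrivial zero. *)
Lemma tangent_direction W : cone_codeword W ->
  exists xy : F * F, xy != (0, 0) /\ \sum_z W (vec3 xy.1 xy.2 z) * z = 0.
Proof.
move=> cW; have [W0 WZ _] := cW.
pose E x y := \sum_z W (vec3 x y z) * z.
have EZ c x y : c != 0 -> E (c * x) (c * y) = c * E x y.
  move=> c0; rewrite /E mulr_sumr (reindex (fun z => c * z)) /=.
    by apply: eq_bigr => z _; rewrite -vec3Z WZ // mulrCA.
  by exists (fun z => c^-1 * z) => z _; rewrite mulrA ?mulVf ?divff ?mul1r.
pose K : F := \prod_(c | c != 0) c.
have K0 : K != 0 by rewrite prodf_seq_neq0; apply/allP => c _; apply/implyP.
(* Test against [z] times the forms [x - c y] for [c] different from [0] and [m]: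
   only the directions (1,0), (0,1) and (m,1) survive. *)
have lin m : m != 0 -> m * E 1 0 + K * (E m 1 - E 0 1) = 0.
  move=> m0; pose C := [pred c : F | (c != 0) && (c != m)].
  pose ls := form3 0 0 1 :: [seq form3 1 (- c) 0 | c <- enum C].
  pose t x y : F := \prod_(c in C) (x - c * y).
  have cC : #|C| = p.-2.
    have eC : #|[predC C]| = 2.
      transitivity #|[set 0; m]|; last by rewrite cards2 eq_sym m0.
      by apply: eq_card => c; rewrite !inE negb_and !negbK.
    by have := cardC C; rewrite eC card_Fp // addn2 => /(congr1 (fun n => n.-2)).
  have szls : size ls = p.-1 by rewrite /= size_map -cardE cC; lia.
  have /esym := cone_codeword_forms p_prime cW szls.
  have -> : \sum_v W v * \prod_(l <- ls) ev v l = \sum_x \sum_y E x y * t x y.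
    rewrite big_vec3; apply: eq_bigr => x _; apply: eq_bigr => y _.
    rewrite /E mulr_suml; apply: eq_bigr => z _; rewrite big_cons ev_vec3 !mulr0 !add0r mulr1.
    rewrite mulrA; congr (_ * _); rewrite big_map big_enum; apply: eq_bigr => c _.
    by rewrite ev_vec3; ring.
  rewrite sum_homogeneous => [|c x y c0]; last first.
    rewrite EZ //; have -> : t (c * x) (c * y) = c ^+ p.-2 * t x y.
      rewrite -cC -prodr_const -big_split /=; apply: eq_bigr => d _; ring.
    rewrite mulrACA -exprS prednK; last by lia.
    by rewrite expf_pred_Fp // c0 mul1r.
  have E00 : E 0 0 * t 0 0 = 0.
    apply/eqP; rewrite mulf_eq0 orbC.
    have [c cc] : exists c, c \in C by apply/card_gt0P; rewrite cC; lia.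
    by rewrite /t (bigD1 c) //= mulr0 subrr mul0r eqxx.
  have t10 : t 1 0 = 1 by apply: big1 => c _; rewrite mulr0 subr0.
  (* The reflection [c -> m - c] permutes the scalars other than [0] and [m]. *)
  have tm : m * t m 1 = K.
    rewrite /K (bigD1 m) //=; congr (_ * _); rewrite [RHS](reindex (fun c => m - c)) /=; last first.
      by exists (fun c => m - c) => c _; rewrite subKr.
    apply: eq_big => [c|c _]; last by rewrite mulr1.
    rewrite !inE subr_eq0 [m == c]eq_sym -[m - c == m]subr_eq0 addrAC subrr sub0r.
    by rewrite oppr_eq0 andbC.
  have t0 : m * t 0 1 = - K.
    rewrite /K (bigD1 m) //= -mulrN; congr (_ * _).
    have -> : t 0 1 = \prod_(c in C) (-1 * c) by apply: eq_bigr => c _; ring.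
    rewrite big_split /= prodr_const cC -[RHS]mulN1r; congr (_ * _).
    have -> : p.-2 = (p - 3)./2.*2.+1.
      by have := even_prime p_prime; lia.
    by rewrite exprS -muln2 mulnC exprM sqrrN !expr1n mulr1.
  rewrite E00 add0r t10 mulr1 (bigD1 0) //= (bigD1 m) //= big1 => [|c /andP[c0 cm]]; last first.
    rewrite /t (bigD1 c) ?inE ?c0 //=; first by rewrite mulr1 subrr mul0r mulr0.
  rewrite addr0 card_Fp // -mulr_natr natr_pred_Fp // mulrN1 => /eqP.
  rewrite eq_sym oppr_eq0 => /eqP e.
  transitivity (m * E 1 0 + (E 0 1 * (m * t 0 1) + E m 1 * (m * t m 1))).
    by rewrite t0 tm; ring.
  by rewrite !(mulrCA _ m) -!mulrDr e mulr0.
have [e|E10] := eqVneq (E 1 0) 0.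
  by exists (1, 0); split=> //; rewrite xpair_eqE oner_eq0.
have [e|E01] := eqVneq (E 0 1) 0.
  by exists (0, 1); split=> //; rewrite xpair_eqE oner_eq0 andbF.
(* Setting [E m 1 = 0] in [lin] gives this [m], which is nonzero as [lin] requires. *)
exists (K * E 0 1 / E 1 0, 1); split; first by rewrite xpair_eqE oner_eq0 andbF.
have /lin : K * E 0 1 / E 1 0 != 0 by rewrite !mulf_neq0 ?invr_eq0.
rewrite divfK // -mulrDr => /eqP; rewrite mulf_eq0 (negPf K0) /= addrC subrK.
by move/eqP.
Qed.

(** In coordinates with [v = (0, 0, 1)], the tangent joins [v] to [(x, y, 0)], where [(x, y)] comes
    from [tangent_direction]. *)
Lemma exists_tangent W v : cone_codeword W -> v != 0 -> W v = 0 ->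
  exists l, [/\ l != 0, ev v l = 0
    & forall u, ev u l = 0 -> \sum_b W (u + b *: v) * b = 0].
Proof.
move=> cW v0 Wv.
have [|g gU eg] := @vec_transitive F (vec3 0 0 1) v _ v0.
  by rewrite vec3_eq0 oner_eq0 !andbF.
have cW' := cone_codeword_mulmx gU cW.
have [[x y] /= [xy0 Exy]] := tangent_direction cW'.
exists (invmx g *m form3 y (- x) 0); split.
- rewrite -(inj_eq (can_inj (mulKmx gU))) mulKVmx // mulmx0 form3_eq0 oppr_eq0 eqxx andbT.
  by apply: contra xy0 => /andP[/eqP-> /eqP->].
- by rewrite -eg ev_mulmx mulKVmx // ev_vec3; ring.
move=> u; rewrite -[u](mulmxKV gU) ev_mulmx mulKVmx // -eg.
set u' := u *m _; rewrite [u']vec3E; move: (u' 0 0) (u' 0 1) (u' 0 2) => a b c.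
rewrite ev_vec3 => eab.
have [d [-> ->]] : exists d, a = d * x /\ b = d * y.
  have eab' : a * y = b * x by apply/eqP; rewrite -subr_eq0 -eab; apply/eqP; ring.
  have [x0|x0] := eqVneq x 0.
    have y0 : y != 0 by apply: contra xy0 => /eqP->; rewrite x0.
    exists (b / y); rewrite divfK // x0 mulr0; split=> //.
    by apply: (mulIf y0); rewrite eab' x0 mulr0 mul0r.
  by exists (a / x); rewrite divfK //; split=> //; apply: (mulIf x0); rewrite -eab'; field.
(* With [z = b + c] the sum splits into that of [W * z] and [- c] times that of [W], which is zero
   by [cone_line_sum_vec3]. *)
rewrite (reindex (fun z => z - c)) /=; last first.
  by exists (fun z => z + c) => z _; rewrite ?subrK ?addrK.
transitivity (\sum_z W (vec3 (d * x) (d * y) z *m g) * (z - c)).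
  apply: eq_bigr => z _; congr (W _ * _); rewrite scalemxAl -mulmxDl; congr (_ *m _).
  by rewrite vec3Z vec3D !mulr0 !addr0 mulr1 addrC subrK.
under eq_bigr => z _ do rewrite mulrBr.
rewrite sumrB -mulr_suml (cone_line_sum_vec3 _ _ cW') ?mul0r ?subr0; last by rewrite eg.
have [->|d0] := eqVneq d 0.
  apply: big1 => z _; rewrite !mul0r; have [->|z0] := eqVneq z 0; first by rewrite mulr0.
  have [_ WZ _] := cW.
  have -> : vec3 0 0 z *m g = z *: v by rewrite -eg scalemxAl vec3Z !mulr0 mulr1.
  by rewrite WZ // Wv mul0r.
rewrite (reindex (fun z => d * z)) /=; last first.
  by exists (fun z => d^-1 * z) => z _; rewrite mulrA ?mulVf ?divff ?mul1r.
transitivity (d * \sum_z W (vec3 x y z *m g) * z); last by rewrite Exy mulr0.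
rewrite mulr_sumr; apply: eq_bigr => z _.
by rewrite -vec3Z -scalemxAl; have [_ WZ _] := cW; rewrite WZ // mulrCA.
Qed.

End Tangents.

(** * Lower bounds for the support *)

Lemma double_count (I J : finType) (A : {set I}) (P : I -> J -> bool) :
  (\sum_(i in A) #|[set j | P i j]| = \sum_j #|[set i in A | P i j]|)%N.
Proof.
under eq_bigr => i _ do rewrite -sum1_card big_mkcond.
rewrite exchange_big; apply: eq_bigr => j _ /=.
rewrite -sum1_card [RHS]big_mkcond [LHS]big_mkcond; apply: eq_bigr => i _.
by rewrite !inE; case: (i \in A).
Qed.

Section WeightBounds.
Variable p : nat.
Hypotheses (p_prime : prime p) (p_gt2 : (2 < p)%N).
Local Notation F := 'F_p.
Implicit Types (W : 'rV[F]_3 -> F) (v : 'rV[F]_3) (l : 'cV[F]_3).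

(* For a zero [v] of [W], the sum over [b] is, up to sign, the derivative at [v]
   in the direction [u] of the polynomial representing [W]. *)
Definition tangent W l v :=
  [forall u, (ev u l == 0) ==> (\sum_b W (u + b *: v) * b == 0)].

Lemma tangentZ W l v c : c != 0 -> tangent W l (c *: v) = tangent W l v.
Proof.
move=> c0; apply: eq_forallb => u; congr (_ ==> _).
rewrite (reindex (fun b => c^-1 * b)) /=; last first.
  by exists (fun b => c * b) => b _; rewrite mulrA ?mulVf ?divff ?mul1r.
under eq_bigr => b _ do rewrite scalerA mulrAC mulVf // mul1r mulrCA.
by rewrite -mulr_sumr mulf_eq0 invr_eq0 (negPf c0).
Qed.

(** In the coordinate [m] on the line, [u] is the point at infinity. Each tangent zero is a root of
    the numerator [R] of a sum of simple fractions with poles at the support [A]; [R] is nonzero of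
    degree below [#|A|]. *)
Lemma card_tangents_lt W u v : cone_codeword W -> W u != 0 ->
    \sum_s \sum_t W (s *: u + t *: v) = 0 ->
  (#|[set m | (W (m *: u + v) == 0)
      && (\sum_b W (u + b *: (m *: u + v)) * b == 0)]%R|
    < #|[set m | W (m *: u + v) != 0]%R|)%N.
Proof.
move=> [W0 WZ _] Wu sum0.
set T := [set m | _ && _]; set A := [set m | _].
pose g a := W (a *: u + v).
have A0 : A != set0.
  apply: contraNneq Wu => A0; move: sum0; rewrite sum_homogeneous => [|c s t c0]; last first.
    by rewrite -!scalerA -scalerDr WZ.
  rewrite !scale0r addr0 W0 add0r scale1r addr0 big1 => [|m _]; last first.
    by apply/eqP; rewrite scale1r; have := in_set0 m; rewrite -A0 inE => /negbFE.
  rewrite addr0 card_Fp // -mulr_natr natr_pred_Fp // mulrN1 => /eqP.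
  by rewrite oppr_eq0.
(* Up to the factor [prod_(b in A) (X - b)], [R] is [sum_a g a / (X - a)], whose
   value at [m] is the tangency sum in the direction [u]. *)
pose R := \sum_(a in A) g a *: \prod_(b in A :\ a) ('X - b%:P).
have szR : (size R <= #|A|)%N.
  apply: (big_ind (fun q : {poly F} => (size q <= #|A|)%N)) => [|q q' sq sq'|a aA].
  - by rewrite size_poly0.
  - by apply: leq_trans (size_polyD _ _) _; rewrite geq_max sq sq'.
  apply: leq_trans (size_scale_leq _ _) _.
  by rewrite -big_enum size_prod_XsubC -cardE [#|A|](cardsD1 a) aA.
have [a0 a0A] := set0Pn _ A0.
have R0 : R != 0.
  apply: contraTneq (a0A) => /(congr1 (fun q => q.[a0])); rewrite horner0.
  rewrite horner_sum (bigD1 a0) //= [X in _ + X]big1 => [|a /andP[aA aa0]]; last first.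
    rewrite hornerZ (bigD1 a0) /= ?hornerM ?hornerXsubC ?subrr ?mul0r ?mulr0 //.
    by rewrite in_setD1 eq_sym aa0.
  rewrite addr0 hornerZ horner_prod => /eqP; rewrite mulf_eq0 inE -/(g a0) negbK => /orP[//|].
  rewrite (negPf (_ : _ != 0)) //; apply/prodf_neq0 => b; rewrite !inE => /andP[ba _].
  by rewrite hornerXsubC subr_eq0 eq_sym.
rewrite [#|T|]cardE; apply: leq_trans szR; apply: max_poly_roots => //; last exact: enum_uniq.
apply/allP=> m; rewrite mem_enum inE => /andP[/eqP gm /eqP tm].
have mA b : b \in A -> m - b != 0.
  by rewrite subr_eq0; apply: contraTneq => <-; rewrite inE gm eqxx.
rewrite /root horner_sum.
have -> : \sum_(a in A) (g a *: \prod_(b in A :\ a) ('X - b%:P)).[m] =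
    - (\prod_(b in A) (m - b)) * \sum_a g a * (a - m)^-1.
  rewrite mulr_sumr [RHS](bigID (mem A)) /= [X in _ = _ + X]big1 ?addr0 => [|a]; last first.
    by rewrite inE negbK -/(g a) => /eqP->; rewrite mul0r mulr0.
  apply: eq_bigr => a aA; rewrite hornerZ horner_prod [in RHS](bigD1 a) //=.
  under eq_bigr => b _ do rewrite hornerXsubC.
  rewrite (eq_bigl (fun b => (b \in A) && (b != a))) => [|b]; last by rewrite !inE andbC.
  have ma := mA a aA; have am : a - m != 0 by rewrite -oppr_eq0 opprB.
  by field.
suff -> : \sum_a g a * (a - m)^-1 = 0 by rewrite mulr0.
(* The substitution [a = m + b^-1] rests on [u + b *: (m *: u + v) = b *: ((m + b^-1) *: u + v)]. At
   [b = 0], where [0^-1 = 0], the terms on both sides have a zero factor. *)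
rewrite -[RHS]tm [LHS](reindex (fun b => m + b^-1)) /=; last first.
  exists (fun a => (a - m)^-1) => a _; first by rewrite addrC addKr invrK.
  by rewrite invrK addrC subrK.
apply: eq_bigr => b _; rewrite (_ : m + b^-1 - m = b^-1) ?invrK; last by ring.
have [->|b0] := eqVneq b 0; first by rewrite !mulr0.
congr (_ * _); rewrite /g -(WZ b) //; congr W.
by rewrite !scalerDr !scalerA mulrDr divff // scalerDl scale1r addrA [u + _]addrC.
Qed.

(** Each point stands for [p - 1] vectors. The support point [u] at infinity counts one and the
    strict inequality of [card_tangents_lt] one more, hence the [2]. *)
Lemma card_line_support W l : cone_codeword W -> l != 0 ->
    (exists v, ev v l = 0 /\ W v != 0) ->
  (2 * p.-1 + #|[set v | [&& ev v l == 0, v != 0, W v == 0 & tangent W l v]]%R|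
    <= #|[set v | (ev v l == 0) && (W v != 0)]%R|)%N.
Proof.
move=> cW l0 [u [ul Wu]]; have [W0 WZ Wl] := cW.
have u0 : u != 0 by apply: contraNneq Wu => ->; rewrite W0.
have [v [vl sumE]] := ker_form_basis l0 u0 ul.
have count (Q : pred 'rV[F]_3) : ~~ Q 0 -> (forall c w, c != 0 -> Q (c *: w) = Q w) ->
    #|[set w | (ev w l == 0) && Q w]| = ((Q u + #|[set m | Q (m *: u + v)%R]|) * p.-1)%N.
  move=> Q0 QZ; rewrite -sum1_card.
  under eq_bigl => w do rewrite inE.
  rewrite big_mkcondr sumE sum_homogeneous_nat => [|c s t c0]; last first.
    by rewrite -!scalerA -scalerDr QZ.
  rewrite !scale0r addr0 (negPf Q0) scale1r addr0 add0n card_Fp //; congr (_ * _)%N.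
  case: (Q u); congr (_ + _)%N; rewrite -sum1_card [RHS]big_mkcond; apply: eq_bigr => m _;
  by rewrite inE scale1r.
rewrite (count (fun w => W w != 0)); [|by rewrite W0 eqxx|by move=> c w c0; rewrite WZ].
rewrite (count (fun w => [&& w != 0, W w == 0 & tangent W l w])); [|by rewrite eqxx|].
  2: by move=> c w c0; rewrite WZ // tangentZ // scaler_eq0 (negPf c0).
rewrite Wu (negPf Wu) andbF /= add0n -mulnDl leq_mul2r; apply/orP; right.
rewrite add1n addSn ltnS add1n.
have sum0 : \sum_s \sum_t W (s *: u + t *: v) = 0 by rewrite -sumE Wl.
apply: leq_ltn_trans (card_tangents_lt cW Wu sum0); apply: subset_leq_card.
apply/subsetP=> m; rewrite !inE => /and3P[_ -> /forallP/(_ u)].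
by rewrite ul eqxx.
Qed.

(** Double count of incidences between support vectors and the forms that are not multiples of [m0].
    Each form gives [2 * p.-1] plus its number of tangent zeros by [card_line_support]; each vector
    is a zero of at most [p ^ 2 - 1] nonzero forms. *)
Lemma count_support_lower_bound W m0 s : cone_codeword W -> m0 != 0 ->
    (forall l, (forall c, l != c *: m0) -> exists v, ev v l = 0 /\ W v != 0) ->
  #|[set v | W v != 0]| = s ->
  (2 * p.-1 * (p ^ 3 - p) + p.-1 * (p ^ 3 - p ^ 2 - s) <= s * (p ^ 2 - 1))%N.
Proof.
move=> cW m00 meets <- {s}; set s := #|_|; have [W0 WZ _] := cW.
pose L := ~: [set c *: m0 | c : F].
have inL l : l \in L -> forall c, l != c *: m0.
  by rewrite inE => lL c; apply: contra lL => /eqP->; apply: imset_f.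
have cardL : #|L| = (p ^ 3 - p)%N.
  rewrite cardsCs setCK card_mx card_Fp // card_imset ?card_Fp //.
  by move=> c d /eqP; rewrite -subr_eq0 -scalerBl scaler_eq0 (negPf m00) orbF subr_eq0 => /eqP.
have l0 l : l \in L -> l != 0 by move=> /inL/(_ 0); rewrite scale0r.
pose tang l v := [&& ev v l == 0, v != 0, W v == 0 & tangent W l v].
pose meet l v := (ev v l == 0) && (W v != 0).
have hL : (\sum_(l in L) (2 * p.-1 + #|[set v | tang l v]|)
            <= \sum_(l in L) #|[set v | meet l v]|)%N.
  by apply: leq_sum => l lL; apply: card_line_support => //; [exact: l0 | exact/meets/inL].
move: hL; rewrite big_split /= sum_nat_const cardL !double_count => hL.
apply: leq_trans (leq_trans _ hL) _.
  rewrite mulnC leq_add2l.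
  (* Only zeros off the line [m0] are used: their tangents cannot be multiples of [m0], so they lie
     in [L], with all [p - 1] nonzero multiples. *)
  pose N := [set v | (ev v m0 != 0) && (W v == 0)].
  have cN : (p ^ 3 - p ^ 2 - s <= #|N|)%N.
    have -> : (p ^ 3 - p ^ 2)%N = #|[set v | ev v m0 != 0]|.
      rewrite (cardsCs [set v | _ != _]) card_mx card_Fp //.
      have <- : #|[set v | ev v m0 == 0]| = (p ^ 2)%N by rewrite card_ker_form // card_Fp.
      by congr (_ - _)%N; apply: eq_card => v; rewrite !inE negbK.
    rewrite leq_subLR -cardsUI; apply: leq_trans (leq_addr _ _); apply: subset_leq_card.
    by apply/subsetP=> v; rewrite !inE => ->; case: eqP.
  apply: leq_trans (leq_mul (leqnn _) cN) _.
  rewrite mulnC -sum_nat_const big_mkcond; apply: leq_sum => v _.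
  rewrite inE; case: ifP => // /andP[vm0 /eqP Wv].
  have v0 : v != 0 by apply: contraNneq vm0 => ->; rewrite /ev mul0mx mxE.
  have [l [ll0 evl tl]] := exists_tangent p_prime p_gt2 cW v0 Wv.
  have <- : #|[set c *: l | c in [set~ (0 : F)]]| = p.-1.
    rewrite card_imset ?cardsC1 ?card_Fp //.
    by move=> c d /eqP; rewrite -subr_eq0 -scalerBl scaler_eq0 (negPf ll0) orbF subr_eq0 => /eqP.
  apply: subset_leq_card; apply/subsetP=> l' /imsetP[c]; rewrite !inE => c0 ->.
  rewrite /tang evZr evl mulr0 eqxx v0 Wv eqxx /=; apply/andP; split.
    apply/imsetP=> -[d _ e]; have := congr1 (ev v) e.
    rewrite !evZr evl mulr0 => /esym/eqP; rewrite mulf_eq0 (negPf vm0) orbF => /eqP d0.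
    by move/eqP: e; rewrite d0 scale0r scaler_eq0 (negPf ll0) (negPf c0).
  apply/forallP=> u; apply/implyP; rewrite evZr mulf_eq0 (negPf c0) /= => /eqP ul.
  by rewrite tl.
rewrite /s -sum_nat_const [leqRHS]big_mkcond; apply: leq_sum => v _; rewrite inE.
have [Wv|Wv] /= := eqVneq (W v) 0; last first.
  have v0 : v != 0 by apply: contraNneq Wv => ->; rewrite W0.
  have /(congr1 (fun n => n - 1)%N) := card_ann_vec v0.
  rewrite (cardsD1 0) inE ev0r eqxx add1n subn1 /= card_Fp // => <-.
  apply: subset_leq_card; apply/subsetP=> l; rewrite !inE => /andP[lL /andP[-> _]].
  by rewrite andbT; apply: l0; rewrite inE.
by rewrite leqn0 cards_eq0; apply/eqP/setP=> l; rewrite !inE /meet Wv eqxx !andbF.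
Qed.

(** The pencil consists of the lines through [(0, 0, 1)], with [x = 0] missing. If the bound failed,
    [p - 1] linear forms could vanish at all support points but [(1, m, z0)], against
    [cone_codeword_forms]. *)
Lemma pencil_line_support W m z0 :
    cone_codeword W -> (forall y z, W (vec3 0 y z) = 0) -> W (vec3 1 m z0) != 0 ->
  (p + 2 <= #|[set z | W (vec3 1 m z) != 0]%R|
    + #|[set m' | [exists z, W (vec3 1 m' z) != 0]]%R|)%N.
Proof.
move=> cW Wx0 Wz0; have [W0 WZ _] := cW; rewrite leqNgt; apply/negP=> lt_hr.
set Z := [set z | _] in lt_hr; set M := [set m' | _] in lt_hr.
have mM : m \in M by rewrite inE; apply/existsP; exists z0.
have zZ : z0 \in Z by rewrite inE.
(* These are [y - m' x] for the other lines of the pencil that meet the support, [z - z' x] for the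
   other support points on [y = m x], and copies of [x] that raise the number to [(#|M| - 1) + (#|Z|
   - 1) + (p + 1 - #|Z| - #|M|) = p - 1]. *)
pose ls := [seq form3 (- m') 1 0 | m' <- enum (M :\ m)]
  ++ [seq form3 (- z) 0 1 | z <- enum (Z :\ z0)] ++ nseq (p + 1 - #|Z| - #|M|) (form3 1 0 0).
have szls : size ls = p.-1.
  rewrite !size_cat !size_map size_nseq -!cardE.
  have := cardsD1 m M; have := cardsD1 z0 Z; rewrite mM zZ /=.
  by move: #|M :\ m| #|Z :\ z0| #|M| #|Z| lt_hr; lia.
have := cone_codeword_forms p_prime cW szls.
pose f v := W v * \prod_(l <- ls) ev v l; rewrite -[\sum_v _]/(\sum_v f v).
have -> : \sum_v f v = \sum_c f (c *: vec3 1 m z0).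
  rewrite big_vec3; apply: eq_bigr => x _.
  rewrite (bigD1 (x * m)) //= [X in _ + X]big1 ?addr0 => [|y yx].
    rewrite (bigD1 (x * z0)) //= [X in _ + X]big1 ?addr0 => [|z zx].
      by rewrite vec3Z mulr1.
    rewrite /f; have [->|x0] := eqVneq x 0; first by rewrite Wx0 mul0r.
    have [->|] := eqVneq (W (vec3 x (x * m) z)) 0; first by rewrite mul0r.
    have -> : vec3 x (x * m) z = x *: vec3 1 m (z / x).
      by rewrite vec3Z mulr1 mulrCA divff // mulr1.
    rewrite WZ // => Wz; rewrite [X in _ * X](_ : _ = 0) ?mulr0 //; apply/eqP.
    rewrite prodf_seq_eq0; apply/hasP; exists (form3 (- (z / x)) 0 1).
      rewrite !mem_cat; apply/or3P/Or32/map_f; rewrite mem_enum !inE Wz andbT.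
      by apply: contra zx => /eqP <-; rewrite mulrCA divff // mulr1.
    by rewrite evZl ev_vec3 mul1r mulr0 addr0 mulr1 addNr mulr0 eqxx.
  apply: big1 => z _; rewrite /f; have [->|x0] := eqVneq x 0; first by rewrite Wx0 mul0r.
  have [->|] := eqVneq (W (vec3 x y z)) 0; first by rewrite mul0r.
  have -> : vec3 x y z = x *: vec3 1 (y / x) (z / x).
    by rewrite vec3Z mulr1 !mulrA ![x * _]mulrC !mulfK.
  rewrite WZ // => Wy; rewrite [X in _ * X](_ : _ = 0) ?mulr0 //; apply/eqP.
  rewrite prodf_seq_eq0; apply/hasP; exists (form3 (- (y / x)) 1 0).
    rewrite !mem_cat; apply/or3P/Or31/map_f; rewrite mem_enum !inE.
    apply/andP; split; last by apply/existsP; exists (z / x).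
    by apply: contra yx => /eqP <-; rewrite mulrCA divff // mulr1.
  by rewrite evZl ev_vec3 mul1r mulr0 addr0 mulr1 addNr mulr0 eqxx.
have prodZ c : \prod_(l <- ls) ev (c *: vec3 1 m z0) l =
    c ^+ p.-1 * \prod_(l <- ls) ev (vec3 1 m z0) l.
  rewrite -szls; elim: (ls) => [|l ls' IH]; first by rewrite !big_nil mul1r.
  by rewrite !big_cons IH evZl exprS mulrACA.
rewrite sum_scalar_multiples => [||c c0].
- rewrite card_Fp // -mulr_natr natr_pred_Fp // mulrN1 scale1r => /eqP.
  rewrite oppr_eq0 mulf_eq0 (negPf Wz0) prodf_seq_eq0 => /hasP[l].
  rewrite !mem_cat => /or3P[/mapP[m']|/mapP[z]|/nseqP[]].
  + rewrite mem_enum !inE => /andP[m'm _] ->.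
    by rewrite ev_vec3 mulr0 addr0 mulr1 mul1r addrC subr_eq0 eq_sym (negPf m'm).
  + rewrite mem_enum !inE => /andP[z'z _] ->.
    by rewrite ev_vec3 mulr0 addr0 mulr1 mul1r addrC subr_eq0 eq_sym (negPf z'z).
  by move=> -> _; rewrite ev_vec3 !mulr0 !addr0 mulr1 oner_eq0.
- by rewrite /f scale0r W0 mul0r.
by rewrite /f scale1r prodZ expf_pred_Fp // c0 mul1r WZ.
Qed.

Lemma two_missing_lines W : cone_codeword W -> (exists v, W v != 0) ->
    (forall y z, W (vec3 0 y z) = 0) -> (forall x z, W (vec3 x 0 z) = 0) ->
  exists2 k, #|[set v | W v != 0]| = (k * p.-1)%N & (k = 2 * p \/ 3 * p - 3 <= k)%N.
Proof.
move=> cW [v0 Wv0] Wx0 Wy0; have [W0 WZ _] := cW.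
pose h m := #|[set z | W (vec3 1 m z) != 0]|.
pose M := [set m | [exists z, W (vec3 1 m z) != 0]].
exists (\sum_m h m)%N.
  rewrite -sum1_card big_mkcond big_vec3 (bigD1 0) //= big1 ?add0n => [|y _]; last first.
    by apply: big1 => z _; rewrite inE Wx0 eqxx.
  rewrite (eq_bigr (fun=> \sum_m h m)%N) => [|x x0]; last first.
    rewrite (reindex (fun y => x * y)) /=; last first.
      by exists (fun z => x^-1 * z) => z _; rewrite mulrA ?mulVf ?divff ?mul1r.
    apply: eq_bigr => y _; rewrite (reindex (fun y => x * y)) /=; last first.
      by exists (fun z => x^-1 * z) => z _; rewrite mulrA ?mulVf ?divff ?mul1r.
    rewrite /h -sum1_card [RHS]big_mkcond; apply: eq_bigr => z _.
    by rewrite !inE -{1}[x]mulr1 -vec3Z WZ.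
  rewrite sum_nat_const mulnC; congr (_ * _)%N.
  by rewrite -[in RHS](card_Fp p_prime) -(cardC1 (0 : F)); apply: eq_card.
have hM m : m \notin M -> h m = 0%N.
  rewrite inE negb_exists => /forallP Wm; apply/eqP; rewrite cards_eq0.
  by apply/eqP/setP=> z; rewrite !inE (negPf (Wm z)).
have -> : (\sum_m h m = \sum_(m in M) h m)%N.
  by rewrite [RHS]big_mkcond; apply: eq_bigr => m _; case: ifP => // /negbT/hM.
have lo : (#|M| * (p + 2 - #|M|) <= \sum_(m in M) h m)%N.
  rewrite -sum_nat_const; apply: leq_sum => m; rewrite inE => /existsP[z Wz].
  by rewrite leq_subLR [leqRHS]addnC; apply: pencil_line_support Wz.
have hi : (\sum_(m in M) h m <= #|M| * p)%N.
  rewrite -sum_nat_const; apply: leq_sum => m _.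
  by apply: leq_trans (max_card _) _; rewrite card_Fp.
(* Slope [0] is excluded because the line [y = 0] is missing too. *)
have M1 : (#|M| <= p.-1)%N.
  apply: (@leq_trans #|[set~ (0 : F)]|); last by rewrite cardsC1 card_Fp.
  apply: subset_leq_card; apply/subsetP=> m; rewrite !inE => /existsP[z].
  by apply: contraNneq => ->; rewrite Wy0.
have M0 : (0 < #|M|)%N.
  apply/card_gt0P; move: Wv0; rewrite [v0]vec3E; move: (v0 0 0) (v0 0 1) (v0 0 2) => x y z.
  have [->|x0] := eqVneq x 0; first by rewrite Wx0 eqxx.
  move=> Wxyz; exists (y / x); rewrite inE; apply/existsP; exists (z / x).
  by rewrite -(WZ x) // vec3Z mulr1 !mulrA ![x * _]mulrC !mulfK.
(* With [r = #|M|]: for [r = 1] the bounds [p + 1] and [p] conflict, for [r = 2] both are [2p], and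
   for [3 <= r <= p - 1] one has [r (p + 2 - r) - (3p - 3) = (r - 3) (p - 1 - r) >= 0]. *)
move: #|M| (\sum_(m in M) h m)%N lo hi M1 M0 => [//|[|[|r]]] k lo hi M1 _; [lia..|].
right; apply: leq_trans lo.
have [d ->] : exists d, p = (r + 4 + d)%N by exists (p - (r + 4))%N; lia.
have -> : (r + 4 + d + 2 - r.+3 = d + 3)%N by lia.
by rewrite leq_subLR; nia.
Qed.

Lemma cone_weight W k : cone_codeword W ->
    #|[set v | W v != 0]| = (k * p.-1)%N -> (0 < k)%N ->
  (k = 2 * p \/ 3 * p - 3 <= k)%N.
Proof.
move=> cW ek k0.
have p1 : (0 < p.-1)%N by lia.
have exW : exists v, W v != 0.
  have : (0 < #|[set v | W v != 0]%R|)%N by rewrite ek muln_gt0 k0.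
  by case/card_gt0P=> v; rewrite inE; exists v.
pose missing l := [forall v, (ev v l == 0) ==> (W v == 0)].
(* If at most one line is missing, [m0] is that line, or any line when there is none. *)
case: (pickP (fun m0 : 'cV[F]_3 =>
    (m0 != 0) && [forall l, missing l ==> [exists c, l == c *: m0]])).
  move=> m0 /andP[m00 /forallP only_m0].
  have hs := count_support_lower_bound cW m00 _ ek.
  have {}hs : (2 * p.-1 * (p ^ 3 - p) + p.-1 * (p ^ 3 - p ^ 2 - k * p.-1)
      <= k * p.-1 * (p ^ 2 - 1))%N.
    apply: hs => l nl; have: ~~ missing l.
      apply: contraPN (only_m0 l) => -> /= /existsP[c]; apply/negP; exact: nl.
    by rewrite negb_forall => /existsP[v]; rewrite negb_imply => /andP[/eqP ? ?]; exists v.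
  move: hs; rewrite (mulnC 2) -!mulnA -mulnDr [(k * (p.-1 * _))%N]mulnCA leq_pmul2l // => {}hs.
  (* Up to a factor [p - 1], [hs] implies [k (p + 2) >= 3 p^2 + 2 p], whereas [k = 3 p - 4] gives
     only [3 p^2 + 2 p - 8]. *)
  right; rewrite leqNgt; apply/negP=> lt_k.
  have [q ep] : exists q, p = q.+3 by exists (p - 3)%N; lia.
  move: hs lt_k; rewrite ep /=; clear; nia.
move=> no_m0; have ex m0 : m0 != 0 -> exists2 l, missing l & forall c, l != c *: m0.
  move=> m00; have := no_m0 m0; rewrite m00 => /negbT; rewrite negb_forall => /existsP[l].
  rewrite negb_imply => /andP[ml]; rewrite negb_exists => /forallP nl.
  by exists l.
(* Starting from an arbitrary nonzero form makes [l2] nonzero, so that [ex] applies again and yields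
   a second missing line [l1]. *)
have [|l2 ml2 nl2] := ex (form3 1 0 0); first by rewrite form3_eq0 oner_eq0.
have l20 : l2 != 0 by have := nl2 0; rewrite scale0r.
have [l1 ml1 nl1] := ex l2 l20.
have [g [gU g1 g2]] := form2_transitive l20 nl1.
have miss l v : missing l -> ev v l = 0 -> W v = 0.
  by move=> /forallP/(_ v)/implyP ml /eqP/ml/eqP.
have [|||k' ek' kP] := two_missing_lines (cone_codeword_mulmx gU cW).
- case: exW => v Wv; exists (v *m invmx g); by rewrite mulmxKV.
- by move=> y z; apply: (miss l1) => //; rewrite ev_mulmx g1 ev_vec3; ring.
- by move=> y z; apply: (miss l2) => //; rewrite ev_mulmx g2 ev_vec3; ring.
suff -> : k = k' by [].
apply/eqP; rewrite -(eqn_pmul2r p1) -ek -ek'; apply/eqP.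
rewrite -!sum1_card; under eq_bigl => v do rewrite inE.
by rewrite (big_mulmx _ _ _ gU); apply: eq_bigl => v; rewrite inE.
Qed.

End WeightBounds.

(** * Projective codewords *)

Section Codewords.
Variable p : nat.
Hypothesis p_prime : prime p.
Local Notation F := 'F_p.
Implicit Types (w : Vp p) (W : 'rV[F]_3 -> F) (v : 'rV[F]_3) (l : 'cV[F]_3).

Definition point_of v : option (point p) := insub <[v]>%VS.

(** The default [0] is taken exactly at the zero vector, which spans no point. *)
Definition cone w v : F := oapp w 0 (point_of v).

Lemma vlineZ c v : c != 0 -> <[c *: v]>%VS = <[v]>%VS.
Proof.
move=> c0; apply: subv_anti; rewrite -!memvE memvZ ?memv_line //=.
by rewrite -[X in X \in _](scalerK c0) memvZ ?memv_line.
Qed.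

Lemma vline_pick (x : point p) : <[vpick (val x)]>%VS = val x.
Proof.
have x0 : vpick (val x) != 0.
  by rewrite vpick0 -dimv_eq0 (eqP (valP x)).
by apply/eqP; rewrite eqEdim -memvE memv_pick dim_vline x0 (eqP (valP x)).
Qed.

Lemma card_point_vectors (x : point p) : #|[set v : 'rV[F]_3 | <[v]>%VS == val x]| = p.-1.
Proof.
set u := vpick (val x); have ux : <[u]>%VS = val x by exact: vline_pick.
have u0 : u != 0 by rewrite vpick0 -dimv_eq0 (eqP (valP x)).
rewrite -[in RHS](card_Fp p_prime) -(cardsC1 (0 : F)).
rewrite -(card_imset [set~ (0 : F)] (f := fun c => c *: u)); last first.
  by move=> c d /eqP; rewrite -subr_eq0 -scalerBl scaler_eq0 (negPf u0) orbF subr_eq0 => /eqP.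
apply: eq_card => v; rewrite inE -ux; apply/eqP/imsetP => [vu|[c]]; last first.
  by rewrite !inE => c0 ->; rewrite vlineZ.
have /vlineP[c vc] : v \in <[u]>%VS by rewrite -vu memv_line.
exists c => //; rewrite !inE; apply: contraNneq u0 => c0.
by have := memv_line u; rewrite -vu vc c0 scale0r => /vlineP[d ->]; rewrite scaler0.
Qed.

Lemma sum_point_of (A : nmodType) (f : point p -> A) :
  \sum_v oapp f 0 (point_of v) = (\sum_x f x) *+ p.-1.
Proof.
rewrite -sumrMnl.
transitivity (\sum_(x : point p) \sum_(v : 'rV[F]_3 | <[v]>%VS == val x) f x); last first.
  apply: eq_bigr => x _; rewrite sumr_const -(card_point_vectors x); congr (_ *+ _).
  by apply: eq_card => v; rewrite inE.
rewrite (exchange_big_dep xpredT) //=; apply: eq_bigr => v _.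
rewrite /point_of; case: insubP => [x _ xv|nv] /=.
  by rewrite (big_pred1 x) // => y; rewrite /= -xv (inj_eq val_inj) eq_sym.
by rewrite big_pred0 // => x; apply: contraNF nv => /eqP->; apply: (valP x).
Qed.

Lemma hweight_cone w : #|[set v | cone w v != 0]| = (hweight w * p.-1)%N.
Proof.
transitivity ((\sum_x (w x != 0 : nat)) *+ p.-1).
  rewrite -(sum_point_of (A := nat)) -sum1_card big_mkcond; apply: eq_bigr => v _.
  by rewrite inE /cone; case: point_of => [x|] /=; [case: (w x != 0) |].
have -> n m : n *+ m = (n * m)%N.
  by elim: m => [|m IHm]; rewrite ?muln0 // mulrS mulnS IHm.
congr (_ * _)%N; rewrite /hweight -sum1_card [RHS]big_mkcond.
by apply: eq_bigr => x _; rewrite inE; case: (w x != 0).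
Qed.

Lemma line_sum_cone w (L : line p) :
  \sum_(v in val L) cone w v = dotp w (line_vec L) *+ p.-1.
Proof.
rewrite -sum_point_of big_mkcond; apply: eq_bigr => v _.
rewrite /cone /point_of; case: insubP => [x _ xv|_] /=; last by rewrite if_same.
by rewrite ffunE /incident xv -memvE; case: (v \in _); rewrite ?mulr1 ?mulr0.
Qed.

Lemma mulrn_pred_Fp (x : F) : x *+ p.-1 = - x.
Proof. by rewrite -mulr_natr natr_pred_Fp // mulrN1. Qed.

Definition ker_form l : {vspace 'rV[F]_3} := lker (linfun (mulmxr l)).

Lemma mem_ker_form l v : (v \in ker_form l) = (ev v l == 0).
Proof.
rewrite memv_ker lfunE /= [_ *m _]mx11_scalar -/(ev v l).
apply/eqP/eqP=> [/matrixP/(_ 0 0)|->]; first by rewrite !mxE.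
by rewrite -scalemx1 scale0r.
Qed.

Lemma dim_ker_form l : l != 0 -> \dim (ker_form l) == 2%N.
Proof.
move=> l0; rewrite -(eqn_exp2l _ _ (finNzRing_gt1 F)) -card_vspace.
by rewrite -(card_ker_form l0); apply/eqP/eq_card => v; rewrite inE mem_ker_form.
Qed.

Lemma cone_is_codeword w : in_Cp_dual w -> cone_codeword (cone w).
Proof.
move=> dw.
have W0 : cone w 0 = 0.
  by rewrite /cone /point_of insubF // dim_vline eqxx.
have Wl l : l != 0 -> \sum_(v | ev v l == 0) cone w v = 0.
  move=> l0; pose L : line p := Sub (ker_form l) (dim_ker_form l0).
  under eq_bigl => v do rewrite -mem_ker_form.
  rewrite -[ker_form l]/(val L) line_sum_cone dw ?mul0rn //.
  by apply: memv_span; apply: map_f; rewrite mem_enum.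
split=> [//|c v c0|l]; first by rewrite /cone /point_of vlineZ.
have [->|/Wl//] := eqVneq l 0.
(* For [l = 0], add up the sums over all nonzero forms: each nonzero vector is counted [p^2 - 1]
   times, which is [-1] modulo [p]. *)
have : \sum_(l | l != 0) \sum_(v | ev v l == 0) cone w v = 0 by exact: big1.
rewrite (exchange_big_dep xpredT) //= => e.
under eq_bigl => v do rewrite ev0r eqxx.
apply/eqP; rewrite -oppr_eq0 -sumrN -[X in _ == X]e; apply/eqP; apply: eq_bigr => v _.
have [->|v0] := eqVneq v 0; first by rewrite W0 oppr0 big1.
rewrite sumr_const.
have -> : #|[pred l : 'cV[F]_3 | (l != 0) && (ev v l == 0)]| = (p ^ 2).-1.
  have := card_ann_vec v0; rewrite (cardsD1 0) inE ev0r eqxx card_Fp // => <-.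
  by apply: eq_card => m; rewrite !inE.
apply/eqP; rewrite eq_sym -subr_eq0 opprK -mulrSr prednK ?expn_gt0 ?prime_gt0 //.
by rewrite -mulr_natr natrX pchar_Fp_0 // expr0n mulr0.
Qed.

Lemma in_Cp_dual_lines w :
  (forall L : line p, dotp w (line_vec L) = 0) -> in_Cp_dual w.
Proof.
move=> dw c; rewrite /Cp => /(@coord_span _ _ _ (in_tuple _)) ->.
rewrite /dotp.
under eq_bigr => x _ do rewrite sum_ffunE mulr_sumr.
rewrite exchange_big big1 //= => i _.
set b := _`_i; have /mapP[L _ ->] : b \in [seq line_vec L | L : line p] by apply: mem_nth.
transitivity (coord (in_tuple [seq line_vec L | L : line p]) i c * dotp w (line_vec L)).
  2: by rewrite dw mulr0.
by rewrite /dotp mulr_sumr; apply: eq_bigr => x _; rewrite ffunE mulrCA.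
Qed.

(** By polarization it suffices to treat powers [l^(p-1)]. Their sum counts the vectors of [U]
    outside the kernel of [l]: [#|U|] minus the cardinality of a subspace of positive dimension,
    both divisible by [p]. *)
Lemma plane_forms (U : {vspace 'rV[F]_3}) ls : \dim U == 2%N -> size ls = p.-1 ->
  \sum_(v in U) \prod_(l <- ls) ev v l = 0.
Proof.
move=> dU szls.
rewrite big_mkcond; transitivity (\sum_v (v \in U)%:R * \prod_(l <- ls) ev v l).
  by apply: eq_bigr => v _; case: (v \in U); rewrite ?mul1r ?mul0r.
apply: (polarization p_prime (n := p.-1)) => //; first by rewrite prednK ?prime_gt0.
move=> l; transitivity (#|[set v in U | ev v l != 0]|%:R : F).
  rewrite -sum1_card natr_sum [RHS]big_mkcond; apply: eq_bigr => v _.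
  by rewrite expf_pred_Fp // inE -natrM mulnb; case: (_ && _).
have dUk : (0 < \dim (U :&: ker_form l))%N.
  have := limg_ker_dim (linfun (mulmxr l)) U; rewrite (eqP dU) -/(ker_form l).
  have := dimvS (subvf (linfun (mulmxr l) @: U)%VS); rewrite dimvf /dim /= => d1 d2.
  by rewrite lt0n; apply: contraTneq d1 => d0; move: d2; rewrite d0 add0n => ->.
have dvd_card (V : {vspace 'rV[F]_3}) : (0 < \dim V)%N -> #|V|%:R = 0 :> F.
  by move=> dV; rewrite card_vspace card_Fp // natrX pchar_Fp_0 // expr0n eqn0Ngt dV.
have: #|U| = (#|(U :&: ker_form l)%VS| + #|[set v in U | ev v l != 0%R]|)%N.
  rewrite -(cardID (mem (ker_form l)) (mem U)); congr (_ + _)%N; apply: eq_card => v.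
    by rewrite !inE memv_cap.
  by rewrite !inE mem_ker_form andbC.
move/(congr1 (fun n => n%:R : F)); rewrite natrD !dvd_card ?(eqP dU) //.
by rewrite add0r.
Qed.

(** The way back from curves to codewords: by [plane_forms], a homogeneous polynomial of degree
    [p - 1], given as a combination of products of linear forms, defines an element of the dual. *)
Lemma dual_weight_forms n (a : 'I_n -> F) (lss : 'I_n -> seq 'cV[F]_3) k :
    (forall i, size (lss i) = p.-1) -> k <> 0%N ->
    #|[set v | \sum_i a i * \prod_(l <- lss i) ev v l != 0]| = (k * p.-1)%N ->
  dual_weight p k.
Proof.
move=> szl k0; pose W v := \sum_i a i * \prod_(l <- lss i) ev v l.
have p1 : (0 < p.-1)%N by have := prime_gt1 p_prime; lia.
have WZ c v : W (c *: v) = c ^+ p.-1 * W v.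
  rewrite /W mulr_sumr; apply: eq_bigr => i _; rewrite mulrCA; congr (_ * _).
  rewrite -(szl i); elim: (lss i) => [|l ls IH]; first by rewrite !big_nil mul1r.
  by rewrite !big_cons IH evZl exprS mulrACA.
have W0 : W 0 = 0 by rewrite -[0 in LHS](scale0r 0) WZ expr0n eqn0Ngt p1 mul0r.
rewrite -[X in X = _]/(#|[set v | W v != 0]|) => eW.
(* The choice of representative is immaterial, since [c^(p-1) = 1] for nonzero [c]. *)
pose w : Vp p := [ffun x : point p => W (vpick (val x))].
have cw v : cone w v = W v.
  rewrite /cone /point_of; case: insubP => [x _ xv|] /=.
    have /vlineP[c ec] : v \in <[vpick (val x)]>%VS by rewrite vline_pick xv memv_line.
    rewrite ffunE ec WZ expf_pred_Fp //; have [c0|_] := eqVneq c 0; last by rewrite mul1r.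
    have := valP x; rewrite /= xv ec c0 scale0r dim_vline eqxx //.
  by rewrite dim_vline; have [->|] := eqVneq v 0; rewrite ?W0.
split=> //; exists w; split.
  apply: in_Cp_dual_lines => L; apply/eqP; rewrite -oppr_eq0 -mulrn_pred_Fp -line_sum_cone.
  rewrite (eq_bigr W) // /W exchange_big big1 //= => i _.
  by rewrite -mulr_sumr plane_forms ?mulr0 //; apply: (valP L).
apply/eqP; rewrite -(eqn_pmul2r p1) -hweight_cone -eW; apply/eqP/eq_card => v.
by rewrite !inE cw.
Qed.

End Codewords.

(** * Codewords of weights 2p and 3p - 3 *)

Section Examples.
Variable p : nat.
Hypothesis p_prime : prime p.
Local Notation F := 'F_p.

Lemma card_set_vec3 (P : pred 'rV[F]_3) :
  #|[set v | P v]| = (\sum_x \sum_y \sum_z P (vec3 x y z))%N.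
Proof.
rewrite -sum1_card big_mkcond big_vec3; do 3!apply: eq_bigr => ? _.
by rewrite inE; case: (P _).
Qed.

Lemma sum_neq0_Fp : (\sum_(x : F) (x != 0%R) = p.-1)%N.
Proof.
rewrite -[in RHS](card_Fp p_prime) -(cardC1 (0 : F)) -sum1_card [RHS]big_mkcond.
by apply: eq_bigr => x _; rewrite !inE; case: eqP.
Qed.

Lemma sum_eq_Fp (a : F) : (\sum_(x : F) (x == a) = 1)%N.
Proof. by rewrite (bigD1 a) //= eqxx big1 // => x /negPf->. Qed.

(** The polynomial [x^(p-1) - y^(p-1)] is the line [y = 0] minus the line [x = 0]; the common point
    cancels, leaving [p] points on each. *)
Lemma dual_weight_2p : dual_weight p (2 * p).
Proof.
pose a (i : 'I_2) : F := (-1) ^+ i.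
pose lss (i : 'I_2) := nseq p.-1 (if i == 0 then form3 1 0 0 else form3 0 1 0 : 'cV[F]_3).
apply: (@dual_weight_forms _ p_prime _ a lss).
- by move=> i; rewrite size_nseq.
- by have := prime_gt0 p_prime; lia.
have WE x y z : (\sum_i a i * \prod_(l <- lss i) ev (vec3 x y z) l != 0)
    = ((x == 0) != (y == 0)).
  rewrite !big_ord_recl big_ord0 /a /lss /= !big_nseq !iter_mulr_1 !ev_vec3.
  rewrite !(mulr0, mulr1, addr0, add0r) expr0 expr1 mul1r mulN1r !expf_pred_Fp //.
  by case: (x == 0); case: (y == 0); rewrite /= ?subrr ?subr0 ?sub0r ?oppr_eq0 ?oner_eq0 ?eqxx.
rewrite card_set_vec3.
under eq_bigr => x _ do under eq_bigr => y _ do under eq_bigr => z _ do rewrite WE.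
under eq_bigr => x _ do under eq_bigr => y _ do rewrite sum_nat_const card_Fp //.
under eq_bigr => x _ do rewrite -big_distrr /=.
rewrite -big_distrr /= mulnAC [RHS]mulnC; congr (_ * _)%N.
rewrite (bigD1 0) //= [X in (_ + X)%N](eq_bigr (fun=> 1%N)) => [|x /negPf x0]; last first.
  by rewrite -[RHS](sum_eq_Fp 0); apply: eq_bigr => y _; rewrite x0; case: (y == 0).
rewrite sum_nat_const cardC1 card_Fp // muln1 mul2n -addnn; congr (_ + _)%N.
by rewrite -[RHS]sum_neq0_Fp; apply: eq_bigr => y _; rewrite eqxx; case: (y == 0).
Qed.

(** The sum is [(x^(p-1) - y^(p-1)) / (x - y)], or [- x^(p-2)] when [y = x]. Its support is the
    union of the lines [x = 0], [y = 0] and [x = y] without their common point. *)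
Lemma geometric_sum_neq0 (x y : F) : (2 < p)%N ->
  (\sum_(i < p.-1) x ^+ (p.-2 - i) * y ^+ i != 0)
    = if x == 0 then y != 0 else (y == 0) || (y == x).
Proof.
move=> p2; have p1 : p.-1 = p.-2.+1 by lia.
have [<-|nxy] := eqVneq x y.
  rewrite (eq_bigr (fun=> x ^+ p.-2)) => [|i _].
    rewrite sumr_const card_ord -mulr_natr natr_pred_Fp // mulrN1 oppr_eq0 expf_eq0.
    by rewrite (_ : (0 < p.-2)%N) /= ?eqxx ?orbT; [case: (x == 0) | lia].
  by rewrite -exprD subnK // -ltnS -p1.
have := subrXX x y p.-1; rewrite !expf_pred_Fp // => e.
have xy0 : (x - y == 0) = false by rewrite subr_eq0 (negPf nxy).
rewrite -[X in X != 0](mulKf (negbT xy0)) -e mulf_eq0 invr_eq0 xy0 /=.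
rewrite orbF.
by case: (x == 0); case: (y == 0); rewrite /= ?subrr ?subr0 ?sub0r ?oppr_eq0 ?oner_eq0 ?eqxx.
Qed.

(** Multiplying the sum of [geometric_sum_neq0] by [z] also removes the points on [z = 0], so
    [p - 1] points remain on each of three concurrent lines. *)
Lemma dual_weight_3p3 : (2 < p)%N -> dual_weight p (3 * p - 3).
Proof.
move=> p2; pose lss (i : 'I_p.-1) : seq 'cV[F]_3 :=
  form3 0 0 1 :: nseq (p.-2 - i) (form3 1 0 0) ++ nseq i (form3 0 1 0).
apply: (@dual_weight_forms _ p_prime _ (fun=> 1) lss).
- by move=> i; rewrite /= size_cat !size_nseq; have := ltn_ord i; lia.
- by lia.
have WE x y z : (\sum_i 1 * \prod_(l <- lss i) ev (vec3 x y z) l != 0)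
    = (z != 0) && (if x == 0 then y != 0 else (y == 0) || (y == x)).
  rewrite -geometric_sum_neq0 // -negb_or -mulf_eq0 mulr_sumr; congr (_ != 0).
  apply: eq_bigr => i _; rewrite mul1r /lss big_cons big_cat !big_nseq !ev_vec3.
  by rewrite !(mulr0, mulr1, addr0, add0r) !iter_mulr_1.
rewrite card_set_vec3.
under eq_bigr => x _ do under eq_bigr => y _ do under eq_bigr => z _ do rewrite WE -mulnb.
under eq_bigr => x _ do under eq_bigr => y _ do rewrite -big_distrl sum_neq0_Fp /=.
under eq_bigr => x _ do rewrite -big_distrr /=.
rewrite -big_distrr mulnC /=; congr (_ * _)%N.
rewrite (bigD1 0) //= sum_neq0_Fp [X in (_ + X)%N](eq_bigr (fun=> 2)) => [|x x0].
  by rewrite sum_nat_const cardC1 card_Fp //; lia.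
rewrite (negPf x0).
transitivity (\sum_(y : F) (y == 0%R) + \sum_(y : F) (y == x))%N; last by rewrite !sum_eq_Fp.
rewrite -big_split /=.
apply: eq_bigr => y _; have [->|_] := eqVneq y 0; rewrite ?[0 == x]eq_sym ?(negPf x0) //.
Qed.

End Examples.

Local Close Scope ring_scope.

Theorem theorem1p2 (p : nat) (p_prime : prime p) (p_ge5 : 5 <= p) :
  is_smallest (dual_weight p) (2 * p) /\
  is_second_smallest (dual_weight p) (3 * p - 3).
Proof.
have p2 : 2 < p by lia.
have w2p : dual_weight p (2 * p) by exact: dual_weight_2p.
have wP n : dual_weight p n -> (n = 2 * p \/ 3 * p - 3 <= n).
  move=> [n0 [w [dw en]]]; rewrite -en in n0 *.
  apply: (cone_weight p_prime p2 (cone_is_codeword p_prime dw)); first exact: hweight_cone.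
  by rewrite lt0n; apply/eqP.
have min2p : is_smallest (dual_weight p) (2 * p).
  by split=> // n /wP; lia.
split=> //; exists (2 * p); split=> //; split.
  split; [exact: dual_weight_3p3 | lia].
by move=> n [/wP]; lia.
Qed.
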